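(* Let $p\in[1,\infty)$ and let $(X,\rho,\mu)$ be a doubling metric measure space supporting the $(1,p)$-Poincaré inequality. If $f\in L^1_{\mathrm{loc}}(\mu)$ satisfies $$\Big[(x,y)\mapsto\frac{|f(x)-f(y)|^p}{\rho(x,y)^p}\frac{1}{V(x,y)}\Big]\in L^1_{\mathrm{loc}}(\mu\times\mu),$$ then $f$ is equal to a constant $\mu$-almost everywhere. In particular, $$\dot B^1_{p,p}(\mu):=\Big\{f\in L^p_{\mathrm{loc}}(\mu):\iint_{X\times X}\Big(\frac{|f(x)-f(y)|}{\rho(x,y)}\Big)^p\frac{d\mu(x)\,d\mu(y)}{V(x,y)}<\infty\Big\}=\{\text{constants}\}.$$
   Context: A metric measure space $(X,\rho,\mu)$ is doubling if there is a constant $c_\mu$ with $\mu(B(x,2r))\le c_\mu\,\mu(B(x,r))$ for all $x\in X$, $r>0$, where $B(x,r)=\{y:\rho(x,y)<r\}$; as usual, all balls have positive and finite measure. Completeness is not assumed. $V(x,y):=\mu(B(x,\rho(x,y)))$; the integrands above are understood to vanish when $x=y$. $L^q_{\mathrm{loc}}(\mu)$ is the class of measurable $f$ with $1_Bf\in L^q(\mu)$ for every ball $B$; $L^1_{\mathrm{loc}}(\mu\times\mu)$ means integrability over $B\times B$ for every ball $B\subset X$. $\langle f\rangle_B:=\frac1{\mu(B)}\int_Bf\,d\mu$. ''Constants'' means functions equal to a constant $\mu$-a.e. Pointwise Lipschitz constant: $\operatorname{lip}f(x):=\liminf_{t\to0}\sup_{\rho(x,y)\le t}\frac{|f(x)-f(y)|}{t}$.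 $(1,p)$-Poincaré inequality: there are constants $\lambda\in[1,\infty)$ and $c_P\in(0,\infty)$ such that $$\frac{1}{\mu(B(z,r))}\int_{B(z,r)}|f-\langle f\rangle_{B(z,r)}|\,d\mu\le c_P\, r\Big(\frac{1}{\mu(B(z,\lambda r))}\int_{B(z,\lambda r)}(\operatorname{lip}f)^p\,d\mu\Big)^{1/p}$$ for all $z\in X$, $r>0$ and all Lipschitz functions $f$ on $X$. *)

(* Defs.v *)
From HB Require Import structures.
From mathcomp Require Import all_boot all_order all_algebra.
From mathcomp Require Import all_classical all_reals all_analysis.

Set Implicit Arguments.
Unset Strict Implicit.
Unset Printing Implicit Defensive.
Import Order.TTheory GRing.Theory Num.Theory.
Import numFieldNormedType.Exports.

Local Open Scope classical_set_scope.
Local Open Scope ring_scope.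

(* Metric spaces carrying their Borel sigma-algebra. No completeness is
   assumed; [ball x r] is the open ball [set y | mdist x y < r], and it is
   empty when r <= 0. *)
HB.mixin Record isBorel d T & Measurable d T & Topological T := {
  measurable_borelE : @measurable d T = <<s @open T >>
}.

#[short(type="borelMetricType")]
HB.structure Definition BorelMetric d (K : numDomainType) :=
  {T of Metric K T & Measurable d T & isBorel d T}.

Section defs.
Context d (R : realType) (X : borelMetricType d R).
Variable mu : {measure set X -> \bar R}.
Implicit Types (x y z : X) (B : set X) (p q r t : R) (f : X -> R).

Definition doubling : Prop :=
  (forall x r, 0 < r -> (0 < mu (ball x r) < +oo)%E) /\
  exists c : R, forall x r, 0 < r ->
    (mu (ball x (2 * r)) <= c%:E * mu (ball x r))%E.

Definition lipschitz_function f : Prop :=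
  exists L : R, forall x y, `|f x - f y| <= L * mdist x y.

(* lip f (x); \bar R-valued, since f need not be Lipschitz. *)
Definition ptlip f x : \bar R :=
  limf_einf (fun t => ereal_sup
    [set (`|f x - f y| / t)%:E | y in [set y | mdist x y <= t]]) 0^'+.

Definition mean B f : R := (fine (mu B))^-1 * \int[mu]_(x in B) f x.

Definition emean B (g : X -> \bar R) : \bar R :=
  ((mu B)^-1 * \int[mu]_(x in B) g x)%E.

(* The (1,p)-Poincare inequality; [lam] is the dilation constant. *)
Definition poincare p : Prop :=
  exists lam cP : R, [/\ 1 <= lam, 0 < cP &
    forall z r f, 0 < r -> lipschitz_function f ->
      (emean (ball z r) (fun x => `|f x - mean (ball z r) f|%:E) <=
       (cP * r)%:E *
         emean (ball z (lam * r)) (fun x => ptlip f x `^ p) `^ p^-1)%E].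

(* Local here refers to balls, not to compact sets. *)
Definition Lloc q f : Prop :=
  measurable_fun setT f /\
  forall x r, 0 < r -> f \_ (ball x r) \in Lfun mu q%:E.

Definition L1loc_prod (F : X * X -> \bar R) : Prop :=
  forall x r, 0 < r ->
    (mu \x mu)%E.-integrable (ball x r `*` ball x r) F.

(* V(x,y); equals 0 when x = y, since [ball x 0] is empty. *)
Definition vol x y : R := fine (mu (ball x (mdist x y))).

Definition besov_integrand p f (xy : X * X) : \bar R :=
  if xy.1 == xy.2 then 0%E
  else ((`|f xy.1 - f xy.2| / mdist xy.1 xy.2) `^ p / vol xy.1 xy.2)%:E.

Definition ae_constant f : Prop :=
  exists c : R, {ae mu, forall x, f x = c}.

(* The homogeneous Besov space B^1_{p,p}(mu). *)
Definition besov1 p : set (X -> R) :=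
  [set f | Lloc p f /\
    (\int[mu \x mu]_xy besov_integrand p f xy < +oo)%E].

(* Measurability is required explicitly: the Borel sigma-algebra need not be
   mu-complete, so it does not follow from a.e. equality to a constant. *)
Definition constants : set (X -> R) :=
  [set f | measurable_fun setT f /\ ae_constant f].

End defs.

(* Main.v *)
From HB Require Import structures.
Require Import Defs.
From mathcomp Require Import all_boot all_order all_algebra finmap.
From mathcomp Require Import all_classical all_reals all_analysis.
From mathcomp Require Import measurable_realfun ring lra.

(* Averaging [f] against the Lipschitz kernel [(2 - rho(x,y)/t)_+] gives a
   Lipschitz function [f_t].  By doubling, both [lip f_t (x)] and
   [|f_t (x) - f (x)| / t] are at most a constant times
   [t^-1 mu(B(x,t))^-1 \int_{B(x,3t)} |f(y) - f(x)| dmu(y)], hence at most a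
   constant times [H_t(x)^(1/p)], where [H_t(x)] is the integral of
   [|f(x) - f(y)|^p / (rho(x,y)^p V(x,y))] over [y \in B(x,3t)].  On every ball
   the integral of [H_t] is a double integral over a strip that shrinks to the
   diagonal, so it tends to [0] with [t]; the Poincare inequality for [f_t] then
   forces [f] to be constant on the ball.  Doubling makes the space separable,
   which is what makes [rho] and [V] measurable for the product sigma-algebra. *)

Set Implicit Arguments.
Unset Strict Implicit.
Unset Printing Implicit Defensive.
Import Order.TTheory GRing.Theory Num.Theory.
Import numFieldNormedType.Exports.
Local Open Scope classical_set_scope.
Local Open Scope ring_scope.

(** The smoothness is critical: the factor [t^-1] from differentiating the kernel is matched exactly
    by the power of [rho] in the integrand, so the bound on the pointwise Lipschitz constant gains
    no power of [t], and smallness has to come from the thin strip alone. The Poincare inequality is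
    assumed for globally Lipschitz functions only, and averages of a locally integrable [f] need not
    be such. So [f] is first replaced by [squash \o f], which is bounded and has a smaller
    integrand. At a fixed scale [t], averages of a bounded function are Lipschitz on the whole
    space, since the bound takes care of pairs farther apart than [t]. Injectivity of [squash]
    carries the conclusion back to [f]. *)

(* Unlike [ge0_le_integral] this needs no measurability, which is not available
   for [ptlip f]. *)
Lemma le_integral_ge0 d (T : measurableType d) (R : realType)
    (mu : {measure set T -> \bar R}) (D : set T) (f g : T -> \bar R) :
  (forall x, D x -> 0 <= f x)%E -> (forall x, D x -> f x <= g x)%E ->
  (\int[mu]_(x in D) f x <= \int[mu]_(x in D) g x)%E.
Proof.
move=> f0 fg; have g0 x : D x -> (0 <= g x)%E.
  by move=> Dx; rewrite (le_trans (f0 _ Dx))// fg.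
rewrite !ge0_integralE//; apply: le_ereal_sup => _ [h /= hf <-].
exists h => //= x; rewrite (le_trans (hf x))// !patchE.
by case: ifPn => // /set_mem; exact: fg.
Qed.

Lemma measurable_fun_lt_sets d (T : measurableType d) (R : realType) (h : T -> R) :
  (forall s, measurable [set x | h x < s]) -> measurable_fun setT h.
Proof.
move=> mh _; apply: (measurability _ (RGenInftyO.measurableE R)) => //.
move=> _ [_ [s ->] <-]; rewrite setTI (_ : _ @^-1` _ = [set x | h x < s])//.
Qed.

Lemma measurable_set_lt d (T : measurableType d) (R : realType) (f g : T -> R) :
  measurable_fun setT f -> measurable_fun setT g ->
  measurable [set x | f x < g x].
Proof.
move=> mf mg; have := measurable_fun_ltr mf mg measurableT (Y := [set true]).
rewrite setTI; exact.
Qed.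

(** * Borel measurability in a metric space *)

Section borel_metric.
Context d (R : realType) (X : borelMetricType d R).

Lemma measurable_ball (x : X) r : measurable (ball x r).
Proof.
have [r0|r0] := leP r 0.
  rewrite (_ : ball x r = set0)//; apply/seteqP; split => // y.
  by rewrite ballEmdist /= ltNge (le_trans r0)// mdist_ge0.
rewrite measurable_borelE; apply: sub_sigma_algebra.
rewrite openE => y; rewrite ballEmdist /= => xy.
apply/nbhs_ballP; exists (r - mdist x y) => /=; first by rewrite subr_gt0.
move=> z; rewrite ballEmdist /= => yz.
by rewrite (le_lt_trans (metric_triangle x y z))// addrC -ltrBrDr.
Qed.

Lemma measurable_mdistr (x : X) : measurable_fun setT (mdist x).
Proof.
apply: measurable_fun_lt_sets => s.
by have := measurable_ball x s; rewrite ballEmdist.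
Qed.

Lemma measurable_lipschitz (f : X -> R) :
  lipschitz_function f -> measurable_fun setT f.
Proof.
move=> [L fL]; apply: measurable_fun_lt_sets => s.
rewrite measurable_borelE; apply: sub_sigma_algebra.
(* [L] may be zero or negative; [M] is a positive Lipschitz constant by which one can divide. *)
rewrite openE => x /= xs; pose M := `|L| + 1.
have M0 : 0 < M by rewrite /M; have := normr_ge0 L; lra.
apply/nbhs_ballP; exists ((s - f x) / M) => /=.
  by rewrite divr_gt0// subr_gt0.
move=> y; rewrite ballEmdist /= ltr_pdivlMr// => xy.
have : f y - f x <= M * mdist x y.
  rewrite (le_trans (ler_norm _))// distrC (le_trans (fL _ _))// ler_wpM2r//.
    exact: mdist_ge0.
  by rewrite /M; have := ler_norm L; lra.
by rewrite mulrC; lra.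
Qed.

End borel_metric.

(** * Separability *)

Section separable.
Context d (R : realType) (X : borelMetricType d R).
Variable mu : {measure set X -> \bar R}.
Hypothesis mub : forall (x : X) (r : R), 0 < r -> (0 < mu (ball x r) < +oo)%E.

Lemma sigma_finite_balls : sigma_finite setT mu.
Proof.
have [[x0 _]|X0] := pselect (exists x : X, True); last first.
  exists (fun=> set0); last by move=> n; rewrite measure0.
  by apply/seteqP; split => // x; case: X0; exists x.
exists (fun n => ball x0 n.+1%:R) => [|n].
  apply/seteqP; split => // x _.
  exists (Num.bound (mdist x0 x)) => //; rewrite ballEmdist /=.
  by rewrite (lt_le_trans (archi_boundP _)) ?mdist_ge0// ler_nat.
split; [exact: measurable_ball|].
by have /andP[] := mub x0 (ltr0Sn R n).
Qed.

(* Only finitely many of the balls are centered in a given ball and have measure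
   above a given threshold, since their union has finite measure. *)
Lemma countable_disjoint_balls (E : set X) e : 0 < e ->
  trivIset E (fun x => ball x e) -> countable E.
Proof.
move=> e0 tE.
have [[x0 _]|X0] := pselect (exists x : X, True); last first.
  by rewrite (_ : E = set0)//; apply/seteqP; split => // x; case: X0; exists x.
pose F n := [set x | E x /\ ball x0 n%:R x /\ (n.+1%:R^-1%:E <= mu (ball x e))%E].
suff finF n : finite_set (F n).
  apply: (@sub_countable _ _ _ (\bigcup_n F n)).
    apply: subset_card_le => x Ex.
    have /andP[m0 moo] := mub x e0.
    have mf : mu (ball x e) \is a fin_num by rewrite ge0_fin_numE ?ltW.
    have f0 : 0 < fine (mu (ball x e)) by rewrite fine_gt0// m0 moo.
    pose n1 := Num.bound (mdist x0 x).
    pose n2 := Num.bound (fine (mu (ball x e)))^-1.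
    exists (maxn n1 n2) => //; split => //; split.
      rewrite ballEmdist /= (lt_le_trans (archi_boundP (mdist_ge0 _ _)))//.
      by rewrite ler_nat leq_maxl.
    rewrite -(fineK mf) lee_fin -[leRHS]invrK lef_pV2 ?posrE ?invr_gt0//.
    have f1 : 0 <= (fine (mu (ball x e)))^-1 by rewrite invr_ge0 ltW.
    rewrite (le_trans (ltW (archi_boundP f1)))// ler_nat.
    by rewrite (leq_trans _ (leqnSn _))// leq_maxr.
  by apply: bigcup_countable => // n _; exact: finite_set_countable.
apply: contrapT => infF.
have /andP[M0 Moo] : (0 < mu (ball x0 (n%:R + e)) < +oo)%E.
  by apply: mub; rewrite ltr_wpDl.
have Mf : mu (ball x0 (n%:R + e)) \is a fin_num by rewrite ge0_fin_numE ?ltW.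
set M := fine (mu (ball x0 (n%:R + e))).
have M0' : 0 <= M by rewrite fine_ge0// ltW.
(* More than [M * n.+1] disjoint balls of measure at least [n.+1^-1] have total measure above
   [M]. *)
pose k := Num.bound (M * n.+1%:R).
have [B BF kB] := @infinite_set_fset _ _ k infF.
have : (mu (\bigcup_(x in [set` B]) ball x e) <= M%:E)%E.
  rewrite /M fineK//; apply: le_measure; rewrite ?inE.
  - apply: fin_bigcup_measurable => // x _; exact: measurable_ball.
  - exact: measurable_ball.
  - move=> y [x /BF[_ [+ _]]]; rewrite !ballEmdist /= => xn xy.
    by rewrite (le_lt_trans (metric_triangle _ x _))// ltrD.
rewrite measure_fin_bigcup//; last 2 first.
- by apply: sub_trivIset tE => x /BF[].
- by move=> x _; exact: measurable_ball.
apply/negP; rewrite -ltNge.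
apply: (@lt_le_trans _ _ (\sum_(x \in [set` B]) n.+1%:R^-1%:E)%E); last first.
  by apply: lee_fsum => // x /BF[_ []].
rewrite fsbig_finite//= set_fsetK sumEFin lte_fin.
rewrite big_const_seq iter_addr_0 count_predT -[ltRHS]mulr_natl ltr_pdivlMr//.
have := archi_boundP (mulr_ge0 M0' (ler0n R n.+1)).
move=> /lt_le_trans; apply; rewrite ler_nat.
exact: kB.
Qed.

(** The centers of a maximal disjoint family of balls of radius [e] form a [2 * e]-net, and the
    family is countable because its balls are disjoint. The union of these nets over [e = k.+1^-1]
    is dense. *)
Lemma dense_sequence (x0 : X) :
  exists D : nat -> X, forall x e, 0 < e -> exists n, mdist x (D n) < e.
Proof.
have net (k : nat) : {E : set X | countable E /\
    forall x, exists2 y, E y & mdist x y < 2 * k.+1%:R^-1}.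
  have [E [_ tE maxE]] := ex_maximal_disjoint_subcollection
    (fun x : X => ball x k.+1%:R^-1) setT.
  have k0 : 0 < k.+1%:R^-1 :> R by rewrite invr_gt0.
  exists E; split; first exact: countable_disjoint_balls tE.
  move=> x; apply: contrapT => nx.
  have farx y : E y -> 2 * k.+1%:R^-1 <= mdist x y.
    by move=> Ey; rewrite leNgt; apply/negP => ?; apply: nx; exists y.
  have nEx : ~ E x by move=> /farx; rewrite mdistxx leNgt mulr_gt0.
  (* A point [x] far from all of [E] could be added to [E], against maximality. *)
  apply: (maxE (E `|` [set x])) => //.
    split; first by move=> y; left.
    by move=> /(_ x) /= h; apply/nEx/h; right.
  have far y z : E y -> ball y k.+1%:R^-1 z -> ball x k.+1%:R^-1 z -> False.
    move=> /farx; rewrite !ballEmdist /= => xy yz xz.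
    have := metric_triangle x z y; rewrite (metric_sym z y).
    by move: xy yz xz; set u := _^-1; lra.
  move=> y z /= [Ey|->] [Ez|->] //.
  - exact: tE.
  - by move=> [w [yw xw]]; case: (far y w).
  - by move=> [w [xw zw]]; case: (far z w).
pose N := \bigcup_k sval (net k).
have cN : countable N.
  by apply: bigcup_countable => // k _; case: (svalP (net k)).
have dN x e : 0 < e -> exists2 y, N y & mdist x y < e.
  move=> e0; pose k := Num.bound (2 / e).
  have [_ /(_ x)[y Ey xy]] := svalP (net k).
  exists y; first by exists k.
  rewrite (lt_le_trans xy)// ler_pdivrMr// -ler_pdivrMl// mulrC.
  rewrite (le_trans (ltW (archi_boundP _)))//; first by rewrite divr_ge0// ltW.
  by rewrite ler_nat.
have /pfcard_geP[N0|[D]] := cN.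
  by have [y] := dN x0 1 ltr01; rewrite N0.
exists D => x e /(dN x)[y Ny xy].
by have [n _ Dn] := 'surj_D Ny; exists n; rewrite Dn.
Qed.

End separable.

(** The theorem is about a bare measure, whereas Tonelli's theorem asks for a sigma-finite one. The
    equality lets [mu] be rewritten into [nu] throughout the hypotheses and the goal. *)
Lemma sigma_finite_measure_pack d (T : measurableType d) (R : realType)
    (mu : {measure set T -> \bar R}) : sigma_finite setT mu ->
  exists nu : {sigma_finite_measure set T -> \bar R},
    mu = nu :> {measure set T -> \bar R}.
Proof.
move=> sf; pose H1 := isSigmaFinite.Build _ _ _ _ sf.
pose H2 := isSFinite.Build _ _ _ _ (sfinite_measure_sigma_finite sf).
pose nu := HB.pack_for (SigmaFiniteMeasure.type T R) (Measure.sort mu) H2 H1.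
by exists nu; exact: eq_measure.
Qed.

(** * Measurability on the product space *)

Section product_measurability.
Context d (R : realType) (X : borelMetricType d R).
Variable mu : {sigma_finite_measure set X -> \bar R}.
Hypothesis mub : forall (x : X) (r : R), 0 < r -> (0 < mu (ball x r) < +oo)%E.

Lemma measurable_mdist :
  measurable_fun setT (fun xy : X * X => mdist xy.1 xy.2).
Proof.
apply: measurable_fun_lt_sets => s.
have [[x0 _]|X0] := pselect (exists x : X, True); last first.
  rewrite (_ : [set _ | _] = set0)//; apply/seteqP; split => // -[x y].
  by case: X0; exists x.
have [D dD] := dense_sequence mub x0.
(* By density, [mdist x y < s] holds exactly when some [D n] has distances to [x] and [y] adding up
   to less than [s]; each such condition involves only functions of one variable. *)
rewrite (_ : [set _ | _] = \bigcup_n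
    [set xy : X * X | mdist (D n) xy.1 + mdist (D n) xy.2 < s]).
  apply: bigcupT_measurable => n.
  apply: measurable_set_lt; last exact: measurable_cst.
  apply: measurable_funD.
    exact: (measurableT_comp (measurable_mdistr (D n)) measurable_fst).
  exact: (measurableT_comp (measurable_mdistr (D n)) measurable_snd).
apply/seteqP; split => -[x y] /=; last first.
  move=> [n _ /=]; apply: le_lt_trans.
  by rewrite (metric_sym _ x) metric_triangle.
move=> xys; have [|n xn] := dD x ((s - mdist x y) / 2).
  by rewrite divr_gt0// subr_gt0.
exists n => //=; have := metric_triangle (D n) x y.
by rewrite (metric_sym (D n) x); move: xn; lra.
Qed.

(** [vol mu x y] is the measure of the section at [(x, y)] of a measurable set of triples, hence
    measurable in [(x, y)]. *)
Lemma measurable_vol : measurable_fun setT (fun xy : X * X => vol mu xy.1 xy.2).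
Proof.
pose A := [set z : (X * X) * X | mdist z.1.1 z.2 < mdist z.1.1 z.1.2].
have mA : measurable A.
  apply: measurable_set_lt.
  - apply: (measurableT_comp measurable_mdist
      (g := fun z : (X * X) * X => (z.1.1, z.2))).
    exact: (measurable_fun_pair
      (measurableT_comp measurable_fst measurable_fst) measurable_snd).
  - exact: (measurableT_comp measurable_mdist measurable_fst).
have := measurable_fun_xsection mu mA.
move=> /(measurableT_comp (fine_measurable (@measurableT _ (\bar R)))).
congr (measurable_fun _ _); apply/funext => -[x y] /=.
rewrite /vol; congr (fine (mu _)); rewrite ballEmdist.
by apply/seteqP; split => z; rewrite /xsection /= ?inE.
Qed.

(** On the diagonal the difference quotient is 0, and its power is 0 because [p != 0]; the power
    with exponent 0 would be 1. *)
Lemma besov_integrandE (p : R) (f : X -> R) xy : p != 0 -> besov_integrand mu p f xy =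
  ((`|f xy.1 - f xy.2| / mdist xy.1 xy.2) `^ p / vol mu xy.1 xy.2)%:E.
Proof.
move=> p0; rewrite /besov_integrand; case: eqP => // ->.
by rewrite subrr normr0 mul0r powR0// mul0r.
Qed.

Lemma measurable_besov_integrand (p : R) (f : X -> R) : p != 0 ->
  measurable_fun setT f -> measurable_fun setT (besov_integrand mu p f).
Proof.
(* Reciprocals of nonnegative quantities are written as powers with exponent -1, so that
   measurability of real powers applies. *)
move=> p0 mf; apply: (eq_measurable_fun (fun xy =>
  ((`|f xy.1 - f xy.2| * mdist xy.1 xy.2 `^ (-1)) `^ p *
    vol mu xy.1 xy.2 `^ (-1))%:E)).
  move=> xy _; rewrite besov_integrandE// !powR_inv1 ?mdist_ge0//.
  exact: fine_ge0.
apply/measurable_EFinP; apply: measurable_funM; last first.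
  exact: (measurableT_comp (@measurable_powR R _)) measurable_vol.
apply: (measurableT_comp (@measurable_powR R p)); apply: measurable_funM.
  apply: (measurableT_comp (@normr_measurable R setT)).
  by apply: measurable_funB; exact: measurableT_comp.
exact: (measurableT_comp (@measurable_powR R _)) measurable_mdist.
Qed.

Lemma besov_integrand_ge0 (p : R) (f : X -> R) xy : (0 <= besov_integrand mu p f xy)%E.
Proof.
rewrite /besov_integrand; case: ifP => // _; rewrite lee_fin.
by rewrite divr_ge0 ?powR_ge0 ?fine_ge0.
Qed.

End product_measurability.

(** * Lipschitz averages *)

Section averaging.
Context d (R : realType) (X : borelMetricType d R).
Variable mu : {measure set X -> \bar R}.
Hypothesis mub : forall (x : X) (r : R), 0 < r -> (0 < mu (ball x r) < +oo)%E.

Lemma integrable_ball_dominated (h : X -> R) x r M : measurable_fun setT h ->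
  (forall y, `|h y| <= M * \1_(ball x r) y) ->
  mu.-integrable setT (EFin \o h).
Proof.
move=> mh hM.
have [r0|r0] := leP r 0.
  have b0 : ball x r = set0.
    apply/seteqP; split => // y.
    by rewrite ballEmdist /= ltNge (le_trans r0)// mdist_ge0.
  have -> : EFin \o h = cst 0%E; last exact: integrable0.
  apply/funext => y /=; congr (_%:E); apply/eqP; rewrite -normr_le0.
  by rewrite (le_trans (hM y))// b0 indic0 mulr0.
have iB : mu.-integrable setT (EFin \o (\1_(ball x r) : X -> R)).
  have mB := measurable_ball x r; apply/integrableP; split.
    exact/measurable_EFinP.
  under eq_integral do rewrite /= ger0_norm//.
  by rewrite integral_indic ?setIT//; have /andP[] := mub x r0.
have := integrableZl measurableT M iB.
apply: le_integrable => //; first exact/measurable_EFinP.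
by move=> y _ /=; rewrite lee_fin (le_trans (hM y))// ler_norm.
Qed.

Lemma Rintegral_indic_ball x r : \int[mu]_y \1_(ball x r) y = fine (mu (ball x r)).
Proof.
rewrite /Rintegral integral_indic ?setIT//; exact: measurable_ball.
Qed.

Definition kernel (t : R) (x y : X) : R := Num.max 0 (2 - mdist x y / t).

(** Dividing by the mass makes constants reproduce themselves, which [averagedB] exploits. *)
Definition averaged t (g : X -> R) x : R :=
  (\int[mu]_y (g y * kernel t x y)) / \int[mu]_y kernel t x y.

(** Radius [3 * t]: this ball contains the supports, of radius [2 * t], of all kernels centered
    within [t] of [x]. *)
Definition osc t (g : X -> R) x : R :=
  (\int[mu]_y (`|g y - g x| * \1_(ball x (3 * t)) y)) / fine (mu (ball x t)).

Section kernel.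
Variables (t : R).
Hypothesis t0 : 0 < t.

Lemma kernel_ge0 x y : 0 <= kernel t x y.
Proof. by rewrite /kernel le_max lexx. Qed.

Lemma kernel_le x y : kernel t x y <= 2 * \1_(ball x (2 * t)) y.
Proof.
rewrite /kernel ge_max mulr_ge0//= indicE.
have dt : 0 <= mdist x y / t by rewrite divr_ge0 ?mdist_ge0 ?ltW.
case: (boolP (y \in _)) => /=; rewrite ?(mulr1, mulr0); first by lra.
rewrite notin_setE ballEmdist /= => /negP; rewrite -leNgt.
by rewrite subr_le0 ler_pdivlMr.
Qed.

Lemma kernel_ge x y : \1_(ball x t) y <= kernel t x y.
Proof.
rewrite indicE; case: (boolP (y \in _)) => /=; last by rewrite kernel_ge0.
rewrite inE ballEmdist /= -[X in _ < X]mul1r -ltr_pdivrMr// => yt.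
by rewrite /kernel le_max; apply/orP; right; lra.
Qed.

Lemma kernel_lip x x' y : mdist x x' <= t ->
  `|kernel t x y - kernel t x' y| <= mdist x x' / t * \1_(ball x (3 * t)) y.
Proof.
move=> xx'; rewrite indicE.
have tr1 := metric_triangle x x' y; have tr2 := metric_triangle x' x y.
rewrite (metric_sym x' x) in tr2.
case: (boolP (y \in _)) => /=; rewrite ?(mulr1, mulr0) => yB.
  have e1 : mdist x y / t <= mdist x x' / t + mdist x' y / t.
    by rewrite -mulrDl ler_wpM2r// invr_ge0 ltW.
  have e2 : mdist x' y / t <= mdist x x' / t + mdist x y / t.
    by rewrite -mulrDl ler_wpM2r// invr_ge0 ltW.
  have e3 : 0 <= mdist x x' / t by rewrite divr_ge0 ?mdist_ge0 ?ltW.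
  rewrite /kernel; move: e1 e2 e3; set a := mdist x y / t.
  set b := mdist x' y / t; set e := mdist x x' / t => e1 e2 e3.
  rewrite ler_norml; case: (leP 0 (2 - a)); case: (leP 0 (2 - b)) => *;
    apply/andP; split; lra.
(* Outside [ball x (3 * t)], the point [y] is at distance at least [2 * t] from both centers, so
   both kernels vanish. *)
move: yB; rewrite notin_setE ballEmdist /= => /negP; rewrite -leNgt => yB.
have k0 z : 2 * t <= mdist z y -> kernel t z y = 0.
  rewrite -ler_pdivlMr// => zy; rewrite /kernel; apply/eqP.
  by rewrite eq_le ge_max lexx /= subr_le0 zy /= le_max lexx.
by rewrite !k0 ?subrr ?normr0//; lra.
Qed.

Lemma measurable_kernel x : measurable_fun setT (kernel t x).
Proof.
apply: measurable_maxr => //; apply: measurable_funB => //.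
by apply: measurable_funM => //; exact: measurable_mdistr.
Qed.

End kernel.

Variable c : R.
Hypothesis doub : forall (x : X) (r : R), 0 < r ->
  (mu (ball x (2 * r)) <= c%:E * mu (ball x r))%E.

Local Notation m x r := (fine (mu (ball x r))).

Lemma ball_fin_num x (r : R) : 0 < r -> mu (ball x r) \is a fin_num.
Proof. by move=> /(mub x)/andP[? ?]; rewrite ge0_fin_numE// ltW. Qed.

Lemma vol_gt0 x r : 0 < r -> 0 < m x r.
Proof. by move=> /(mub x) h; rewrite fine_gt0. Qed.

Lemma vol_mono x r x' r' : 0 < r' -> mdist x' x + r <= r' -> m x r <= m x' r'.
Proof.
move=> r'0 xr; have mB z s := measurable_ball z s.
have sub : ball x r `<=` ball x' r'.
  move=> y; rewrite !ballEmdist /= => xy.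
  rewrite (le_lt_trans (metric_triangle x' x y))// (lt_le_trans _ xr)//.
  by rewrite ltrD2l.
have le : (mu (ball x r) <= mu (ball x' r'))%E by apply: le_measure; rewrite ?inE.
apply: fine_le => //; last exact: ball_fin_num.
rewrite ge0_fin_numE// (le_lt_trans le)//.
by have /andP[] := mub x' r'0.
Qed.

Lemma vol_doubling x r : 0 < r -> m x (2 * r) <= c * m x r.
Proof.
move=> r0; have r20 : 0 < 2 * r by rewrite mulr_gt0.
by rewrite -lee_fin EFinM !fineK ?ball_fin_num// doub.
Qed.

Lemma doubling_ge1 (x : X) : 1 <= c.
Proof.
have h1 : m x 1 <= m x (2 * 1).
  by apply: vol_mono; [rewrite mulr1|rewrite mdistxx; lra].
have m0 := vol_gt0 x ltr01.
have := le_trans h1 (vol_doubling x ltr01).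
by rewrite -{1}[m x 1]mul1r ler_pM2r.
Qed.

Lemma vol_triple x r : 0 < r -> m x (3 * r) <= c ^+ 2 * m x r.
Proof.
move=> r0; have c1 := doubling_ge1 x.
rewrite (@le_trans _ _ (m x (2 * (2 * r))))//.
  by apply: vol_mono; [rewrite !mulr_gt0|rewrite mdistxx; lra].
rewrite (le_trans (vol_doubling _ _)) ?mulr_gt0//.
by rewrite expr2 -mulrA ler_pM2l ?vol_doubling//; lra.
Qed.

Section estimates.
Variables (t : R) (g : X -> R).
Hypotheses (t0 : 0 < t) (mg : measurable_fun setT g).
Hypothesis g1 : forall x, `|g x| <= 1.

Lemma measurable_osc_integrand x r :
  measurable_fun setT (fun y => `|g y - g x| * \1_(ball x r) y).
Proof.
apply: measurable_funM; last exact/measurable_indic/measurable_ball.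
by apply: (measurableT_comp (@normr_measurable R setT)); apply: measurable_funB.
Qed.

Lemma osc_le2 x y : `|g y - g x| <= 2.
Proof. by rewrite (le_trans (ler_normB _ _))// (lerD (g1 _) (g1 _)). Qed.

Lemma integrable_osc x r :
  mu.-integrable setT (EFin \o (fun y => `|g y - g x| * \1_(ball x r) y)).
Proof.
apply: (integrable_ball_dominated (x := x) (r := r) (M := 2)).
  exact: measurable_osc_integrand.
by move=> y; rewrite normrM normr_id [X in _ * X]ger0_norm// ler_wpM2r// osc_le2.
Qed.

Lemma integrable_kernelM (h : X -> R) (M : R) x : measurable_fun setT h ->
  (forall y, `|h y| <= M) ->
  mu.-integrable setT (EFin \o (fun y => h y * kernel t x y)).
Proof.
move=> mh hM; apply: (integrable_ball_dominated (x := x) (r := 2 * t) (M := 2 * M)).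
  by apply: measurable_funM => //; exact: measurable_kernel.
move=> y; rewrite normrM [X in _ * X]ger0_norm ?kernel_ge0//.
rewrite (mulrC 2) -mulrA ler_pM ?kernel_ge0 ?kernel_le//.
Qed.

Lemma integrable_kernel x : mu.-integrable setT (EFin \o kernel t x).
Proof.
have := @integrable_kernelM (cst 1) 1 x (measurable_cst _).
rewrite (_ : (fun y => cst 1 y * kernel t x y) = kernel t x).
  by apply=> y; rewrite normr1.
by apply/funext => y; rewrite mul1r.
Qed.

Lemma integrable_indic_ball x r : mu.-integrable setT
  (EFin \o (\1_(ball x r) : X -> R)).
Proof.
apply: (integrable_ball_dominated (x := x) (r := r) (M := 1)).
  exact/measurable_indic/measurable_ball.
by move=> y; rewrite ger0_norm// mul1r.
Qed.

Lemma kernel_mass_ge x : m x t <= \int[mu]_y kernel t x y.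
Proof.
rewrite -Rintegral_indic_ball; apply: le_Rintegral => //.
- exact: integrable_indic_ball.
- exact: integrable_kernel.
- by move=> y _; exact: kernel_ge.
Qed.

Lemma kernel_mass_gt0 x : 0 < \int[mu]_y kernel t x y.
Proof. by rewrite (lt_le_trans _ (kernel_mass_ge x))// vol_gt0. Qed.

Lemma averagedB x a : averaged t g x - a =
  (\int[mu]_y ((g y - a) * kernel t x y)) / \int[mu]_y kernel t x y.
Proof.
have D0 : \int[mu]_y kernel t x y != 0 by rewrite gt_eqF ?kernel_mass_gt0.
under eq_Rintegral do rewrite mulrBl.
rewrite RintegralB//; last 2 first.
- exact: integrable_kernelM g1.
- exact: (@integrable_kernelM (cst a) `|a|).
rewrite RintegralZl//; last exact: integrable_kernel.
by rewrite mulrBl mulfK.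
Qed.

Lemma osc_ge0 x : 0 <= osc t g x.
Proof.
apply: divr_ge0; last exact: fine_ge0.
by apply: Rintegral_ge0 => y _; exact: mulr_ge0.
Qed.

Lemma abs_Rint_le (h k : X -> R) :
  mu.-integrable setT (EFin \o h) -> mu.-integrable setT (EFin \o k) ->
  (forall y, `|h y| <= k y) -> `|\int[mu]_y h y| <= \int[mu]_y k y.
Proof.
move=> ih ik hk; rewrite (le_trans (le_normr_Rintegral _ _))//.
apply: le_Rintegral => //.
exact: (integrable_norm ih).
Qed.

(** The kernel is centered at [x'] but the reference value is [g x]: this controls the second
    average in [averaged_lip], and [x' = x] gives [averaged_near]. *)
Lemma kernel_diff_le x x' : mdist x x' <= t ->
  `|\int[mu]_y ((g y - g x) * kernel t x' y)| <= 2 * (osc t g x * m x t).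
Proof.
move=> xx'; rewrite /osc divfK ?gt_eqF ?vol_gt0//.
rewrite -RintegralZl ?integrable_osc//; apply: abs_Rint_le.
- apply: (@integrable_kernelM _ 2) => [|y]; last exact: osc_le2.
  exact: measurable_funB.
- have := integrableZl measurableT 2 (integrable_osc x (3 * t)).
  by apply: eq_integrable => // y _; rewrite /= EFinM.
move=> y; rewrite normrM mulrCA ler_wpM2l// ger0_norm ?kernel_ge0//.
rewrite (le_trans (kernel_le t0 _ _))// ler_wpM2l//.
rewrite !indicE; have [yB|//] := boolP (y \in (ball x' (2 * t) : set X)).
suff -> : y \in (ball x (3 * t) : set X) by [].
move: yB; rewrite !inE !ballEmdist /= => yB.
by rewrite (le_lt_trans (metric_triangle x x' y))//; lra.
Qed.

Lemma averaged_near x : `|averaged t g x - g x| <= 2 * osc t g x.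
Proof.
rewrite averagedB normrM normfV (ger0_norm (ltW (kernel_mass_gt0 x))).
rewrite ler_pdivrMr ?kernel_mass_gt0//.
rewrite (le_trans (kernel_diff_le _)) ?mdistxx ?(ltW t0)//.
by rewrite -[leRHS]mulrA ler_wpM2l// ler_wpM2l ?osc_ge0// kernel_mass_ge.
Qed.

(** A discrete quotient rule, after subtracting [g x] from both averages. The difference of
    numerators contributes 1. The difference of masses contributes [2 * c ^+ 3]: the 2 is the bound
    of the kernel, [c ^+ 2] comes from [vol_triple], and the last [c] from comparing [ball x t] with
    the mass at [x']. *)
Lemma averaged_lip x x' : mdist x x' <= t ->
  `|averaged t g x - averaged t g x'| <=
    (1 + 2 * c ^+ 3) * (mdist x x' / t) * osc t g x.
Proof.
move=> xx'; set rt := mdist x x' / t.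
have rt0 : 0 <= rt by rewrite divr_ge0 ?mdist_ge0 ?ltW.
have c1 := doubling_ge1 x.
rewrite (_ : averaged t g x - _ = (averaged t g x - g x) - (averaged t g x' - g x));
  last by ring.
rewrite !averagedB.
set P := \int[mu]_y ((g y - g x) * kernel t x y).
set P' := \int[mu]_y ((g y - g x) * kernel t x' y).
set D := \int[mu]_y kernel t x y; set D' := \int[mu]_y kernel t x' y.
have D0 : 0 < D := kernel_mass_gt0 x; have D'0 : 0 < D' := kernel_mass_gt0 x'.
have ikd z : mu.-integrable setT (EFin \o (fun y => (g y - g x) * kernel t z y)).
  apply: (@integrable_kernelM _ 2) => [|y]; last exact: osc_le2.
  exact: measurable_funB.
set A := osc t g x; have A0 : 0 <= A := osc_ge0 x.
have m0 := vol_gt0 x t0; have m'0 := vol_gt0 x' t0.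
have PP' : `|P - P'| <= rt * (A * m x t).
  rewrite /A /osc divfK ?gt_eqF// -RintegralB// -RintegralZl ?integrable_osc//.
  apply: abs_Rint_le.
  - have := integrableB measurableT (ikd x) (ikd x').
    by apply: eq_integrable => // y _; rewrite /= EFinB.
  - have := integrableZl measurableT rt (integrable_osc x (3 * t)).
    by apply: eq_integrable => // y _; rewrite /= EFinM.
  move=> y; rewrite -mulrBr normrM mulrCA ler_wpM2l//.
  exact: kernel_lip.
have DD' : `|D' - D| <= rt * (c ^+ 2 * m x t).
  rewrite distrC (@le_trans _ _ (rt * m x (3 * t)))//; last first.
    by rewrite ler_wpM2l// vol_triple.
  rewrite -Rintegral_indic_ball -RintegralB ?integrable_kernel//.
  rewrite -RintegralZl ?integrable_indic_ball//; apply: abs_Rint_le.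
  - have := integrableB measurableT (integrable_kernel x) (integrable_kernel x').
    by apply: eq_integrable => // y _; rewrite /= EFinB.
  - have := integrableZl measurableT rt (integrable_indic_ball x (3 * t)).
    by apply: eq_integrable => // y _; rewrite /= EFinM.
  by move=> y; exact: kernel_lip.
have P'A : `|P'| <= 2 * (A * m x t) := kernel_diff_le xx'.
have mD : m x t <= D := kernel_mass_ge x.
have mD' : m x t <= c * D'.
  have h : m x t <= m x' (2 * t).
    by apply: vol_mono; rewrite ?mulr_gt0// metric_sym; lra.
  rewrite (le_trans h)// (le_trans (vol_doubling _ _))// ler_wpM2l//; first lra.
  exact: kernel_mass_ge.
have -> : P / D - P' / D' = (P - P') / D + P' * (D' - D) / (D * D').
  by field; rewrite !gt_eqF.
rewrite (le_trans (ler_normD _ _))//.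
have -> : (1 + 2 * c ^+ 3) * rt * A = rt * A + 2 * (c ^+ 3 * (rt * A)) by ring.
apply: lerD.
  rewrite normrM normfV (ger0_norm (ltW D0)) ler_pdivrMr//.
  by rewrite (le_trans PP')// -[leRHS]mulrA ler_wpM2l// ler_wpM2l.
rewrite normrM normfV (ger0_norm (ltW (mulr_gt0 D0 D'0))).
rewrite ler_pdivrMr ?mulr_gt0// normrM.
rewrite (@le_trans _ _ (2 * (A * m x t) * (rt * (c ^+ 2 * m x t))))//.
  exact: ler_pM.
have -> : 2 * (A * m x t) * (rt * (c ^+ 2 * m x t)) =
  2 * A * rt * c ^+ 2 * (m x t * m x t) by ring.
have -> : 2 * (c ^+ 3 * (rt * A)) * (D * D') =
  2 * A * rt * c ^+ 2 * (D * (c * D')) by ring.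
apply: ler_wpM2l; last by apply: ler_pM => //; exact: ltW.
have c0 : 0 <= c by lra.
exact: mulr_ge0 (mulr_ge0 (mulr_ge0 (ler0n R 2) A0) rt0) (exprn_ge0 2 c0).
Qed.

Lemma osc_le_const x : osc t g x <= 2 * c ^+ 2.
Proof.
rewrite /osc ler_pdivrMr ?vol_gt0// -mulrA.
rewrite (@le_trans _ _ (2 * m x (3 * t)))//; last by rewrite ler_wpM2l// vol_triple.
rewrite -Rintegral_indic_ball -RintegralZl ?integrable_indic_ball//.
apply: le_Rintegral => //; first exact: integrable_osc.
  have := integrableZl measurableT 2 (integrable_indic_ball x (3 * t)).
  by apply: eq_integrable => // y _; rewrite /= EFinM.
by move=> y _; rewrite ler_wpM2r// osc_le2.
Qed.

(** Pairs within [t] are covered by [averaged_lip] and [osc_le_const]. For the others,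
    [2 + 8 * c ^+ 2] bounds the difference itself: 2 for [g x' - g x], and [4 * c ^+ 2] for each of
    the two errors [averaged t g - g]. *)
Lemma lipschitz_averaged : lipschitz_function (averaged t g).
Proof.
exists ((1 + 2 * c ^+ 3) * (2 * c ^+ 2) / t + (2 + 8 * c ^+ 2) / t) => x x'.
have c1 := doubling_ge1 x; have c0 : 0 <= c by lra.
have c20 := exprn_ge0 2 c0; have c30 := exprn_ge0 3 c0.
have d0 := mdist_ge0 x x'; have t'0 : 0 <= t^-1 by rewrite invr_ge0 ltW.
rewrite mulrDl; have [xx'|tx] := leP (mdist x x') t.
  rewrite -[leLHS]addr0; apply: lerD; last first.
    by rewrite !mulr_ge0//; lra.
  rewrite (le_trans (averaged_lip xx'))//.
  have -> : (1 + 2 * c ^+ 3) * (2 * c ^+ 2) / t * mdist x x' =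
    (1 + 2 * c ^+ 3) * (mdist x x' / t) * (2 * c ^+ 2) by ring.
  rewrite ler_wpM2l ?osc_le_const//.
  by rewrite !mulr_ge0//; lra.
rewrite -[leLHS]add0r; apply: lerD; first by rewrite !mulr_ge0//; lra.
rewrite -mulrA (mulrC t^-1).
have : 1 <= mdist x x' / t by rewrite ler_pdivlMr// mul1r ltW.
set q := mdist x x' / t => q1.
rewrite (@le_trans _ _ (2 + 8 * c ^+ 2))//; last by rewrite ler_peMr//; lra.
have := averaged_near x; have := averaged_near x'.
have := osc_le_const x; have := osc_le_const x'; have := osc_le2 x x'.
move=> h1 h2 h3 h4 h5.
rewrite (_ : averaged t g x - averaged t g x' = (averaged t g x - g x) -
  (averaged t g x' - g x') - (g x' - g x)); last by ring.
rewrite (le_trans (ler_normB _ _))// (le_trans (lerD (ler_normB _ _) (lexx _)))//.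
by lra.
Qed.

End estimates.
End averaging.

(* Replaces Hoelder's inequality: averaged over [u] and optimized in [s], it bounds
   an L^1 mean by an L^p mean. *)
Lemma le_threshold_powR (R : realType) (p s u : R) : 1 <= p -> 0 < s -> 0 <= u ->
  u <= s + s `^ (1 - p) * u `^ p.
Proof.
move=> p1 s0 u0; have [us|su] := leP u s.
  by rewrite (le_trans us)// lerDl mulr_ge0 ?powR_ge0.
rewrite (@le_trans _ _ (s `^ (1 - p) * u `^ p))//; last by rewrite lerDr ltW.
(* For [u > s] the claim amounts to [s]^ (p - 1) <= u [^ (p - 1)]. *)
rewrite -(@mulr_powRB1 _ u p)//; last lra.
rewrite mulrCA -[leLHS]mulr1 ler_wpM2l//.
have -> : 1 - p = - (p - 1) by ring.
rewrite powRN mulrC ler_pdivlMr ?powR_gt0// mul1r.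
by apply: ge0_ler_powR; rewrite ?nnegrE ?subr_ge0// ltW.
Qed.

(** Replaces the root of the energy by an affine expression, which can be integrated directly. *)
Lemma powR_le1D (R : realType) (u r : R) : 0 <= u -> 0 <= r -> r <= 1 ->
  u `^ r <= 1 + u.
Proof.
move=> u0 r0 r1; have [u1|u1] := leP 1 u.
  by rewrite (le_trans (ler1_powR u1 r1))// lerDr.
rewrite (@le_trans _ _ 1)// ?lerDl//.
rewrite -[leRHS](_ : 1 `^ r = 1); last by rewrite powR1.
by apply: ge0_ler_powR; rewrite ?nnegrE// ltW.
Qed.

(** * Pointwise bounds by the energy *)

Lemma ptlip_le d (R : realType) (X : borelMetricType d R) (f : X -> R) x (M t : R) :
  0 < t -> (forall r y, 0 < r -> r <= t -> mdist x y <= r ->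
    `|f x - f y| <= M * r) ->
  (ptlip f x <= M%:E)%E.
Proof.
move=> t0 fM; rewrite /ptlip limf_einfE; apply: ge_ereal_sup => _ [V V0 <-].
(* The lower limit is a supremum, over neighborhoods [V] of [0^'+], of infima; one scale [r <= t] in
   each [V] bounds its infimum. *)
have [r [Vr /andP[r0 rt]]] : exists r, V r /\ 0 < r <= t.
  have near_t : \forall r \near 0^'+, 0 < r <= t.
    near=> r; apply/andP; split; first by near: r; exact: nbhs_right_gt.
    by near: r; exact: nbhs_right_le.
  have [r [Vr rP]] := @filter_ex _ _ _ _ (filterI V0 near_t).
  by exists r.
apply: le_trans (ereal_inf_lbound _) _; first by exists r.
apply: ge_ereal_sup => _ [y /= xy <-].
by rewrite lee_fin ler_pdivrMr// fM.
Unshelve. all: by end_near.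
Qed.

Lemma ptlip_ge0 d (R : realType) (X : borelMetricType d R) (f : X -> R) x :
  (0 <= ptlip f x)%E.
Proof.
rewrite /ptlip limf_einfE.
apply: le_trans (ereal_sup_ubound _); last first.
  exists [set r | 0 < r] => //; exact: nbhs_right_gt.
apply: le_ereal_inf_tmp => _ [r /= r0 <-].
apply: ereal_sup_ubound; exists x; first by rewrite /= mdistxx ltW.
by rewrite subrr normr0 mul0r.
Qed.

Section pointwise.
Context d (R : realType) (X : borelMetricType d R).
Variable mu : {sigma_finite_measure set X -> \bar R}.
Hypothesis mub : forall (x : X) (r : R), 0 < r -> (0 < mu (ball x r) < +oo)%E.
Variable c : R.
Hypothesis doub : forall (x : X) (r : R), 0 < r ->
  (mu (ball x (2 * r)) <= c%:E * mu (ball x r))%E.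
Variables (p t : R) (g : X -> R).
Hypotheses (p1 : 1 <= p) (t0 : 0 < t) (mg : measurable_fun setT g).
Hypothesis g1 : forall x, `|g x| <= 1.

(** The function [H_t] of the overview. It may be infinite at some points, hence the values in
    [\bar R]. *)
Definition energy x : \bar R :=
  (\int[mu]_(y in ball x (3 * t)) besov_integrand mu p g (x, y))%E.

Local Notation m x r := (fine (mu (ball x r))).

Lemma p_neq0 : p != 0. Proof. by rewrite gt_eqF// (lt_le_trans _ p1). Qed.

Lemma energy_ge0 x : (0 <= energy x)%E.
Proof. by apply: integral_ge0 => y _; exact: besov_integrand_ge0. Qed.

(** With [u] the difference quotient, the left side is at most [3 * t * u], to which
    [le_threshold_powR] applies. The weight [vol mu x y] is at most the measure of [ball x (3 * t)],
    so by doubling it can be exchanged for that of [ball x t]. *)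
Lemma diff_le_besov s x y : 0 < s -> ball x (3 * t) y ->
  (`|g y - g x|%:E <= (3 * t * s)%:E +
    (3 * t * (s `^ (1 - p) * (c ^+ 2 * m x t)))%:E * besov_integrand mu p g (x, y))%E.
Proof.
move=> s0 xy; have [<-|xNy] := eqVneq x y.
  rewrite subrr normr0 adde_ge0 ?mule_ge0 ?besov_integrand_ge0 ?lee_fin//.
    by rewrite !mulr_ge0// ltW.
  have c0 : 0 <= c by have := doubling_ge1 mub doub x; lra.
  by rewrite !mulr_ge0 ?powR_ge0 ?exprn_ge0 ?fine_ge0 ?(ltW t0).
rewrite besov_integrandE ?p_neq0//= -EFinM -EFinD lee_fin distrC.
have r0 : 0 < mdist x y by rewrite mdist_gt0.
move: xy; rewrite ballEmdist /= => xy.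
set u := `|g x - g y| / mdist x y.
have u0 : 0 <= u by rewrite divr_ge0 ?mdist_ge0.
have -> : `|g x - g y| = mdist x y * u by rewrite mulrC divfK// gt_eqF.
have V0 : 0 < vol mu x y by apply: vol_gt0.
have Vm : vol mu x y <= c ^+ 2 * m x t.
  rewrite (le_trans _ (vol_triple mub doub x t0))//.
  by apply: vol_mono; rewrite ?mdistxx ?add0r ?mulr_gt0// ltW.
rewrite (@le_trans _ _ (3 * t * (s + s `^ (1 - p) * u `^ p)))//.
  by apply: ler_pM; rewrite ?mdist_ge0 ?le_threshold_powR// ltW.
rewrite mulrDr lerD2l -[leRHS]mulrA ler_wpM2l//; first by rewrite mulr_ge0// ltW.
rewrite -[leRHS]mulrA ler_wpM2l ?powR_ge0// mulrA ler_pdivlMr// mulrC.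
by rewrite ler_wpM2r ?powR_ge0.
Qed.

Lemma osc_le_energy s x : 0 < s -> (energy x < +oo)%E ->
  osc mu t g x <= 3 * t * c ^+ 2 * (s + s `^ (1 - p) * fine (energy x)).
Proof.
move=> s0 Hoo; have c1 := doubling_ge1 mub doub x.
have Hf : energy x \is a fin_num by rewrite ge0_fin_numE ?energy_ge0.
have m0 := vol_gt0 mub x t0.
rewrite /osc ler_pdivrMr// -lee_fin /Rintegral fineK; last first.
  exact: (integrable_fin_num measurableT (integrable_osc mub mg g1 x (3 * t))).
set K := 3 * t * (s `^ (1 - p) * (c ^+ 2 * m x t)).
have K0 : 0 <= K.
  have c0 : 0 <= c by lra.
  by rewrite !mulr_ge0 ?powR_ge0 ?exprn_ge0 ?fine_ge0 ?(ltW t0).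
have mB := measurable_ball x (3 * t).
have mbx : measurable_fun (ball x (3 * t)) (fun y => besov_integrand mu p g (x, y)).
  apply: measurable_funTS.
  have mb := measurable_besov_integrand mub p_neq0 mg.
  exact: (measurableT_comp mb (pair1_measurable x)).
rewrite (@le_trans _ _ (\int[mu]_(y in ball x (3 * t))
    ((3 * t * s)%:E + K%:E * besov_integrand mu p g (x, y))))%E//.
  rewrite [leLHS](_ : _ = \int[mu]_(y in ball x (3 * t)) `|g y - g x|%:E)%E.
    by apply: le_integral_ge0 => y // yB; exact: diff_le_besov.
  rewrite [RHS]integral_mkcond; apply: eq_integral => y _.
  by rewrite patchE indicE; case: ifPn => _; rewrite ?mulr1 ?mulr0.
rewrite ge0_integralD//; last 3 first.
- by move=> y _; rewrite lee_fin !mulr_ge0// ltW.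
- by move=> y _; rewrite mule_ge0 ?besov_integrand_ge0.
- exact: measurable_funeM.
rewrite integral_cst// ge0_integralZl//; last first.
  by move=> y _; exact: besov_integrand_ge0.
rewrite -/(energy x) -[X in (_ + _ * X)%E](fineK Hf).
have t30 : 0 < 3 * t by rewrite mulr_gt0.
rewrite -[X in (_ * X + _)%E](fineK (ball_fin_num mub x t30)).
rewrite -!EFinM -EFinD lee_fin.
rewrite (@le_trans _ _ (3 * t * s * (c ^+ 2 * m x t) + K * fine (energy x)))//.
  rewrite lerD2r ler_wpM2l ?vol_triple//.
  by rewrite !mulr_ge0// ltW.
by rewrite /K le_eqVlt; apply/orP; left; apply/eqP; ring.
Qed.

(* The summand [t] keeps the optimal [s] of [osc_le_energy] positive when the
   energy vanishes. *)
Lemma osc_le_root x : (energy x < +oo)%E ->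
  osc mu t g x <= 6 * c ^+ 2 * t * (fine (energy x) + t) `^ p^-1.
Proof.
move=> Hoo; set h := fine (energy x).
have h0 : 0 <= h by rewrite fine_ge0 ?energy_ge0.
have ht0 : 0 < h + t by rewrite ltr_wpDl.
set s := (h + t) `^ p^-1; have s0 : 0 < s by exact: powR_gt0.
rewrite (le_trans (osc_le_energy s0 Hoo))// -/h.
have sp : s `^ p = h + t.
  by rewrite -powRrM mulVf ?p_neq0// powRr1// ltW.
have hs : s `^ (1 - p) * h <= s.
  rewrite (@le_trans _ _ (s `^ (1 - p) * s `^ p))//.
    by rewrite ler_wpM2l ?powR_ge0// sp lerDl ltW.
  by rewrite -powRD ?(gt_eqF s0) ?implybT// subrK powRr1 ?(ltW s0).
have -> : 6 * c ^+ 2 * t * s = 3 * t * c ^+ 2 * (s + s) by ring.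
rewrite ler_wpM2l ?lerD2l//.
have c1 := doubling_ge1 mub doub x.
have c0 : 0 <= c by lra.
by rewrite !mulr_ge0 ?exprn_ge0 ?(ltW t0).
Qed.

(** The [t^-1] of [averaged_lip] cancels the [t] of [osc_le_root]. Where the energy is infinite, so
    is the right side. *)
Lemma ptlip_averaged_le x : (ptlip (averaged mu t g) x `^ p <=
  (((1 + 2 * c ^+ 3) * (6 * c ^+ 2)) `^ p)%:E * (energy x + t%:E))%E.
Proof.
have c1 := doubling_ge1 mub doub x; have c0 : 0 <= c by lra.
set L := (1 + 2 * c ^+ 3) * (6 * c ^+ 2).
have q0 : 0 < 1 + 2 * c ^+ 3 by have := exprn_ge0 3 c0; lra.
have c20 : 0 < c ^+ 2 by rewrite exprn_gt0//; lra.
have L0 : 0 < L by rewrite mulr_gt0// mulr_gt0.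
have [Hoo|] := ltP (energy x) +oo%E; last first.
  rewrite leye_eq => /eqP ->.
  by rewrite addye// gt0_muley ?lte_fin ?powR_gt0// leey.
have Hf : energy x \is a fin_num by rewrite ge0_fin_numE ?energy_ge0.
set h := fine (energy x).
have h0 : 0 <= h by rewrite fine_ge0 ?energy_ge0.
have : (ptlip (averaged mu t g) x <= (L * (h + t) `^ p^-1)%:E)%E.
  apply: (@ptlip_le _ _ _ _ _ _ t) => // r y r0 rt xy.
  rewrite (le_trans (averaged_lip mub doub t0 mg g1 (le_trans xy rt)))//.
  have := osc_le_root Hoo; rewrite -/h; set w := (h + t) `^ _ => ow.
  have -> : L * w * r = (1 + 2 * c ^+ 3) * (r / t * (6 * c ^+ 2 * t * w)).
    by rewrite /L; field; rewrite gt_eqF.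
  rewrite -[leLHS]mulrA ler_wpM2l ?(ltW q0)//.
  apply: ler_pM => //; first by rewrite divr_ge0 ?mdist_ge0 ?(ltW t0).
    exact: osc_ge0.
  by rewrite ler_wpM2r// invr_ge0 ltW.
move=> le1.
apply: (@le_trans _ _ ((L * (h + t) `^ p^-1)%:E `^ p)%E).
  have p0 : 0 <= p by rewrite (le_trans _ p1).
  apply: (gt0_ler_poweR p0) => //; rewrite in_itv /= leey andbT ?ptlip_ge0//.
  by rewrite lee_fin mulr_ge0 ?powR_ge0// ltW.
rewrite poweR_EFin powRM ?powR_ge0 ?(ltW L0)// -powRrM mulVf ?p_neq0//.
by rewrite powRr1 ?addr_ge0 ?(ltW t0)// EFinM EFinD fineK.
Qed.

(** Here the factor [t] survives, so a bound linear in the energy suffices. *)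
Lemma averaged_near_le x : (`|averaged mu t g x - g x|%:E <=
  (12 * c ^+ 2 * t)%:E * (1 + t%:E + energy x))%E.
Proof.
have c1 := doubling_ge1 mub doub x.
have c20 : 0 < c ^+ 2 by rewrite exprn_gt0//; lra.
have K0 : 0 < 12 * c ^+ 2 * t by rewrite mulr_gt0// mulr_gt0.
have [Hoo|] := ltP (energy x) +oo%E; last first.
  rewrite leye_eq => /eqP ->.
  by rewrite addey// gt0_muley ?lte_fin// leey.
have Hf : energy x \is a fin_num by rewrite ge0_fin_numE ?energy_ge0.
set h := fine (energy x).
have h0 : 0 <= h by rewrite fine_ge0 ?energy_ge0.
rewrite -(fineK Hf) -/h -!EFinD -EFinM lee_fin.
rewrite (le_trans (averaged_near mub t0 mg g1 x))//.
rewrite (@le_trans _ _ (2 * (6 * c ^+ 2 * t * (h + t) `^ p^-1)))//.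
  by rewrite ler_wpM2l// osc_le_root.
have -> : 12 * c ^+ 2 * t * (1 + t + h) =
  2 * (6 * c ^+ 2 * t * (1 + (h + t))) by ring.
rewrite ler_wpM2l// ler_wpM2l//; first by rewrite mulr_ge0 ?(ltW t0)// mulr_ge0// ltW.
have p0 : 0 < p by rewrite (lt_le_trans _ p1).
apply: powR_le1D; first by rewrite addr_ge0// ltW.
  by rewrite invr_ge0 ltW.
by rewrite invf_le1.
Qed.

End pointwise.

(** * Vanishing of the oscillation *)

Section vanishing_energy.
Context d (R : realType) (X : borelMetricType d R).
Variable mu : {sigma_finite_measure set X -> \bar R}.
Hypothesis mub : forall (x : X) (r : R), 0 < r -> (0 < mu (ball x r) < +oo)%E.
Variables (p : R) (g : X -> R).
Hypotheses (p1 : 1 <= p) (mg : measurable_fun setT g).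

Lemma measurable_besov_restrict (S : set (X * X)) : measurable S ->
  measurable_fun setT (besov_integrand mu p g \_ S).
Proof.
move=> mS; apply: (measurable_restrictT _ mS).1; apply: measurable_funTS.
exact: (measurable_besov_integrand mub (p_neq0 p1) mg).
Qed.

Lemma besov_restrict_ge0 (S : set (X * X)) xy :
  (0 <= (besov_integrand mu p g \_ S) xy)%E.
Proof. by apply: erestrict_ge0 => z _; exact: besov_integrand_ge0. Qed.

Lemma measurable_near_diagonal r :
  measurable [set xy : X * X | mdist xy.1 xy.2 < r].
Proof. by apply: measurable_set_lt => //; exact: measurable_mdist mub. Qed.

(** Presents the energy as a section integral for Tonelli's theorem. Only the section of [S] at [x]
    is constrained, so [S] can be the whole strip or its part inside a product of balls. *)
Lemma energyE t (S : set (X * X)) x :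
  (forall y, S (x, y) <-> mdist x y < 3 * t) ->
  energy mu p t g x = (\int[mu]_y (besov_integrand mu p g \_ S) (x, y))%E.
Proof.
move=> Sx; rewrite /energy integral_mkcond; apply: eq_integral => y _.
rewrite !patchE; congr (if _ then _ else _).
apply/idP/idP; rewrite !inE ballEmdist /=; by move=> /Sx.
Qed.

Lemma measurable_energy t : measurable_fun setT (energy mu p t g).
Proof.
pose S := [set xy : X * X | mdist xy.1 xy.2 < 3 * t].
rewrite (_ : energy mu p t g =
  fun x => \int[mu]_y (besov_integrand mu p g \_ S) (x, y))%E; last first.
  by apply/funext => x; apply: energyE.
apply: measurable_fun_fubini_tonelli_F => [|xy]; last first.
  exact: besov_restrict_ge0.
by apply: measurable_besov_restrict; exact: measurable_near_diagonal.
Qed.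

Lemma integral_energy_cvg0 (z : X) r :
  0 < r -> L1loc_prod mu (besov_integrand mu p g) ->
  (\int[mu]_(x in ball z r) energy mu p n.+1%:R^-1 g x)%E @[n --> \oo] --> 0%E.
Proof.
(* The scales [n.+1^-1] are at most 1, so [B'] contains [ball x (3 * n.+1^-1)] for every [x] in
   [ball z r]. *)
move=> r0 loc; pose B' := ball z (r + 3).
pose S n := (B' `*` B') `&` [set xy : X * X | mdist xy.1 xy.2 < 3 * n.+1%:R^-1].
have mB' : measurable (B' `*` B').
  by apply: measurableX; exact: measurable_ball.
have mS n : measurable (S n).
  by apply: measurableI => //; exact: measurable_near_diagonal.
have iB : (mu \x mu)%E.-integrable setT (besov_integrand mu p g \_ (B' `*` B')).
  apply/(integrable_mkcond _ mB'); apply: loc.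
  by rewrite addr_gt0.
have cv0 : {ae (mu \x mu)%E, forall xy, setT xy ->
    (besov_integrand mu p g \_ (S n)) xy @[n --> \oo] --> 0%E}.
  (* The diagonal lies in every strip and has positive measure if [mu] has atoms; there the
     integrand is 0 by definition. Any other point leaves the strips eventually. *)
  apply/nearW => -[x y] _; have [<-|xy] := eqVneq x y.
    rewrite (_ : (fun _ => _) = cst 0%E); first exact: cvg_cst.
    apply/funext => n; rewrite patchE; case: ifP => // _.
    by rewrite /besov_integrand /= eqxx.
  have xy0 : 0 < mdist x y / 3 by rewrite divr_gt0// mdist_gt0.
  apply: cvg_near_cst; near=> n.
  rewrite patchE ifF//; apply/negP; rewrite inE => -[_ /=].
  apply/negP; rewrite -leNgt -ler_pdivlMl// mulrC ltW//.
  by near: n; exact: near_infty_natSinv_lt (PosNum xy0).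
have dom : {ae (mu \x mu)%E, forall xy n, setT xy ->
    (`|(besov_integrand mu p g \_ (S n)) xy| <=
     (besov_integrand mu p g \_ (B' `*` B')) xy)%E}.
  apply/nearW => xy n _; rewrite gee0_abs ?besov_restrict_ge0//.
  rewrite !patchE; case: ifPn => [|_].
    by rewrite inE => -[xyB _]; rewrite mem_set.
  by case: ifPn => // _; exact: besov_integrand_ge0.
have [_ _] := dominated_convergence measurableT
  (fun n => measurable_besov_restrict (mS n)) (measurable_cst _) cv0 iB dom.
rewrite integral_cst// mul0e => H.
apply: (squeeze_cvge _ (cvg_cst 0%E) H); near=> n; apply/andP; split.
  by apply: integral_ge0 => x _; exact: energy_ge0.
rewrite [leRHS](_ : _ = \int[mu]_x \int[mu]_y
    (besov_integrand mu p g \_ (S n)) (x, y))%E; last first.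
  exact: (fubini_tonelli1 _ (measurable_besov_restrict (mS n))
    (besov_restrict_ge0 _)).
rewrite integral_mkcond; apply: le_integral_ge0 => x _.
  by apply: erestrict_ge0 => y _; exact: energy_ge0.
rewrite patchE; case: ifPn => [|_]; last first.
  by apply: integral_ge0 => y _; exact: besov_restrict_ge0.
rewrite inE ballEmdist /= => zx; rewrite (@energyE _ (S n))// => y.
split=> [[]//|xy]; split => //.
have n1 : 3 * n.+1%:R^-1 <= 3 :> R by rewrite ler_piMr// invf_le1// ler1n.
split; rewrite /B' ballEmdist /=; first by rewrite (lt_trans zx)// ltrDl.
rewrite (le_lt_trans (metric_triangle z x y))// ltrD//.
exact: lt_le_trans xy n1.
Unshelve. all: by end_near.
Qed.

End vanishing_energy.

Section mean.
Context d (R : realType) (X : borelMetricType d R).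
Variable mu : {measure set X -> \bar R}.

(** The mean [w] is optimal up to a factor 2, since [|w - a| * mu B] is at most the integral of
    [|g - a|]. It is applied with [a] the mean of the averaged function. *)
Lemma integral_sub_mean_le (B : set X) (g : X -> R) (a : R) :
  measurable B -> (0 < mu B < +oo)%E -> measurable_fun setT g ->
  (forall x, `|g x| <= 1) ->
  (\int[mu]_(x in B) `|g x - mean mu B g|%:E <=
   2%:E * \int[mu]_(x in B) `|g x - a|%:E)%E.
Proof.
move=> mB /andP[B0 Boo] mg g1; set w := mean mu B g.
have mgB : measurable_fun B g by exact: measurable_funTS.
have ig : mu.-integrable B (EFin \o g).
  apply: measurable_bounded_integrable => //.
  by exists 1; split => // M M1 x _ /=; rewrite (le_trans (g1 x))// ltW.
have ic b : mu.-integrable B (EFin \o cst b).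
  apply: measurable_bounded_integrable => //.
  by exists `|b|; split => // M M1 x _ /=; rewrite ltW.
have Bf : mu B \is a fin_num by rewrite ge0_fin_numE ?ltW.
have m0 : 0 < fine (mu B) by rewrite fine_gt0// B0.
have iab b : mu.-integrable B (EFin \o (fun x => `|g x - b|)).
  have := integrable_norm (integrableB mB ig (ic b)).
  by apply: eq_integrable.
have eqw : w - a = (fine (mu B))^-1 * \int[mu]_(x in B) (g x - a).
  have -> : \int[mu]_(x in B) (g x - a) = \int[mu]_(x in B) g x - a * fine (mu B).
    by rewrite -(Rintegral_cst mu mB a); exact: RintegralB mB ig (ic a).
  rewrite mulrBr.
  by rewrite [X in _ = _ - X]mulrC mulfK ?gt_eqF.
have wa : `|w - a| * fine (mu B) <= \int[mu]_(x in B) `|g x - a|.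
  rewrite eqw normrM (ger0_norm (ltW _)) ?invr_gt0// mulrC mulrA mulfV ?gt_eqF//.
  rewrite mul1r; apply: le_normr_Rintegral => //.
  by have := integrableB mB ig (ic a); apply: eq_integrable.
have fab b : (\int[mu]_(x in B) `|g x - b|%:E =
    (\int[mu]_(x in B) `|g x - b|)%:E)%E.
  by rewrite /Rintegral fineK//; exact: integrable_fin_num (iab b).
rewrite !fab -EFinM lee_fin.
rewrite (@le_trans _ _ (\int[mu]_(x in B) (`|g x - a| + `|w - a|)))//.
  apply: le_Rintegral => //.
    by have := integrableD mB (iab a) (ic `|w - a|); apply: eq_integrable.
  move=> x _; rewrite (_ : g x - w = (g x - a) - (w - a)); last by ring.
  exact: ler_normB.
have -> : \int[mu]_(x in B) (`|g x - a| + `|w - a|) =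
    \int[mu]_(x in B) `|g x - a| + `|w - a| * fine (mu B).
  rewrite -(Rintegral_cst mu mB `|w - a|).
  exact: RintegralD mB (iab a) (ic `|w - a|).
by rewrite mulr_natl mulr2n lerD2l.
Qed.

End mean.

Section vanishing_oscillation.
Context d (R : realType) (X : borelMetricType d R).
Variable mu : {sigma_finite_measure set X -> \bar R}.
Hypothesis mub : forall (x : X) (r : R), 0 < r -> (0 < mu (ball x r) < +oo)%E.
Variable c : R.
Hypothesis doub : forall (x : X) (r : R), 0 < r ->
  (mu (ball x (2 * r)) <= c%:E * mu (ball x r))%E.
Variables (p : R) (g : X -> R).
Hypotheses (p1 : 1 <= p) (mg : measurable_fun setT g).
Hypothesis g1 : forall x, `|g x| <= 1.

Local Notation m x r := (fine (mu (ball x r))).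

Lemma integral_energyD (z : X) (r t k del : R) : 0 < r -> 0 < t -> t <= del ->
  0 <= k ->
  (\int[mu]_(x in ball z r) energy mu p t g x <= del%:E)%E ->
  (\int[mu]_(x in ball z r) (energy mu p t g x + (k * t)%:E) <=
    (del * (1 + k * m z r))%:E)%E.
Proof.
move=> r0 t0 td k0 Ed; have mB := measurable_ball z r.
rewrite ge0_integralD//; last 3 first.
- by move=> x _; exact: energy_ge0.
- exact: measurable_funTS (measurable_energy mub p1 mg t).
- by move=> x _; rewrite lee_fin mulr_ge0// ltW.
rewrite integral_cst// -[X in (_ + _ * X)%E](fineK (ball_fin_num mub z r0)).
rewrite mulrDr mulr1 EFinD; apply: leeD => //.
rewrite -EFinM lee_fin mulrA ler_wpM2r ?fine_ge0// mulrC.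
by rewrite ler_wpM2r.
Qed.

Lemma integral_averaged_near (z : X) (r t del : R) :
  0 < r -> 0 < t -> t <= del -> del <= 1 ->
  (\int[mu]_(x in ball z r) energy mu p t g x <= del%:E)%E ->
  (\int[mu]_(x in ball z r) `|averaged mu t g x - g x|%:E <=
    (12 * c ^+ 2 * (1 + 2 * m z r) * del)%:E)%E.
Proof.
move=> r0 t0 td d1 Ed; have mB := measurable_ball z r.
have d0 : 0 < del := lt_le_trans t0 td.
have c0 : 0 <= 12 * c ^+ 2 by rewrite mulr_ge0 ?sqr_ge0.
have mE : measurable_fun (ball z r) (energy mu p t g).
  exact: measurable_funTS (measurable_energy mub p1 mg t).
have E0 x : (0 <= energy mu p t g x)%E by exact: energy_ge0.
rewrite (@le_trans _ _ (\int[mu]_(x in ball z r)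
    ((12 * c ^+ 2)%:E * ((2 * del)%:E + energy mu p t g x))))%E//.
  apply: le_integral_ge0 => // x _.
  rewrite (le_trans (averaged_near_le mub doub p1 t0 mg g1 x))//.
  rewrite EFinM -muleA lee_wpmul2l ?lee_fin//.
  (* Since [t <= del <= 1], [t * (1 + t + energy) <= del * (2 + energy) <= 2 * del + energy]. *)
  rewrite (@le_trans _ _ (del%:E * (2%:E + energy mu p t g x)))%E//.
    apply: lee_pmul => //; rewrite ?lee_fin ?(ltW t0)//.
      by rewrite adde_ge0// lee_fin addr_ge0// ltW.
    by rewrite leeD2r// -EFinD lee_fin lerD2l (le_trans td).
  rewrite ge0_muleDr ?lee_fin// -EFinM mulrC leeD2l//.
  by rewrite -[leRHS]mul1e lee_wpmul2r.
rewrite ge0_integralZl//; last 2 first.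
- exact: emeasurable_funD.
- by move=> x _; rewrite adde_ge0// lee_fin mulr_ge0// ltW.
rewrite ge0_integralD//; last by move=> x _; rewrite lee_fin mulr_ge0// ltW.
rewrite integral_cst// -[X in (_ * (_ * X + _))%E](fineK (ball_fin_num mub z r0)).
have -> : 12 * c ^+ 2 * (1 + 2 * m z r) * del =
  12 * c ^+ 2 * (2 * del * m z r + del) by ring.
rewrite [leRHS]EFinM lee_wpmul2l ?lee_fin// EFinD leeD// -EFinM lee_fin.
Qed.

Lemma integral_averaged_sub_mean (z : X) (r lam cP t del : R) :
  0 < r -> 1 <= lam -> 0 < cP -> 0 < t -> t <= del -> del <= 1 ->
  (emean mu (ball z r) (fun x => `|averaged mu t g x -
       mean mu (ball z r) (averaged mu t g)|%:E) <=
   (cP * r)%:E * emean mu (ball z (lam * r))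
       (fun x => ptlip (averaged mu t g) x `^ p) `^ p^-1)%E ->
  (\int[mu]_(x in ball z (lam * r)) energy mu p t g x <= del%:E)%E ->
  (\int[mu]_(x in ball z r) `|averaged mu t g x -
      mean mu (ball z r) (averaged mu t g)|%:E <=
    (m z r * (cP * r) * ((m z (lam * r))^-1 *
      ((1 + 2 * c ^+ 3) * (6 * c ^+ 2)) `^ p *
      (1 + m z (lam * r))) `^ p^-1 * del `^ p^-1)%:E)%E.
Proof.
move=> r0 lam1 cP0 t0 td d1 + Ed.
have lr0 : 0 < lam * r by rewrite mulr_gt0// (lt_le_trans _ lam1).
set u := averaged mu t g; set a := mean mu (ball z r) u.
set b := m z r; set bl := m z (lam * r).
have b0 : 0 < b := vol_gt0 mub z r0.
have bl0 : 0 < bl := vol_gt0 mub z lr0.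
set L := ((1 + 2 * c ^+ 3) * (6 * c ^+ 2)) `^ p.
have L0 : 0 <= L := powR_ge0 _ _.
have d0 : 0 < del := lt_le_trans t0 td.
have p0 : 0 < p by rewrite (lt_le_trans _ p1).
rewrite /emean -(fineK (ball_fin_num mub z r0)) -(fineK (ball_fin_num mub z lr0)).
rewrite -/b -/bl !inver !gt_eqF// => poi.
rewrite (_ : integral _ _ _ = b%:E * (b^-1%:E *
  \int[mu]_(x in ball z r) `|u x - a|%:E))%E; last first.
  by rewrite muleA -EFinM mulfV ?gt_eqF// mul1e.
set Q := (bl^-1 * L * (1 + bl)) `^ p^-1; set D := del `^ p^-1.
have -> : b * (cP * r) * Q * D = b * ((cP * r) * (Q * D)) by ring.
rewrite [leRHS]EFinM lee_wpmul2l ?lee_fin ?(ltW b0)//.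
rewrite (le_trans poi)// [leRHS]EFinM lee_wpmul2l ?lee_fin ?mulr_ge0 ?(ltW r0) ?(ltW cP0)//.
rewrite /Q /D -powRM; last 2 first.
- by rewrite !mulr_ge0 ?addr_ge0 ?invr_ge0 ?(ltW bl0).
- exact: ltW.
rewrite -poweR_EFin; apply: gt0_ler_poweR.
- by rewrite invr_ge0 ltW.
- rewrite in_itv /= leey andbT mule_ge0 ?lee_fin ?invr_ge0 ?(ltW bl0)//.
  by apply: integral_ge0 => x _; exact: poweR_ge0.
- rewrite in_itv /= leey andbT lee_fin.
  by rewrite !mulr_ge0 ?addr_ge0 ?invr_ge0 ?(ltW bl0) ?(ltW d0).
have -> : bl^-1 * L * (1 + bl) * del = bl^-1 * (L * (del * (1 + bl))) by ring.
rewrite [leRHS]EFinM lee_wpmul2l ?lee_fin ?invr_ge0 ?(ltW bl0)//.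
have mB := measurable_ball z (lam * r).
have mE : measurable_fun (ball z (lam * r)) (energy mu p t g).
  exact: measurable_funTS (measurable_energy mub p1 mg t).
rewrite (@le_trans _ _ (\int[mu]_(x in ball z (lam * r))
    (L%:E * (energy mu p t g x + (1 * t)%:E))))%E//.
  apply: le_integral_ge0 => x _; first exact: poweR_ge0.
  by rewrite mul1r; exact: ptlip_averaged_le.
rewrite ge0_integralZl//; last 2 first.
- exact: emeasurable_funD.
- by move=> x _; rewrite adde_ge0 ?energy_ge0// lee_fin mulr_ge0// ltW.
rewrite [leRHS]EFinM lee_wpmul2l ?lee_fin//.
by rewrite (le_trans (integral_energyD lr0 t0 td ler01 Ed))// mul1r.
Qed.

Hypothesis poi : poincare mu p.
Hypothesis loc : L1loc_prod mu (besov_integrand mu p g).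

(** The left side does not involve the scale and [M] does not depend on [del], so [del] may tend to
    0. For each [del] a scale is chosen below [del] at which the energy integrates to less than
    [del] over the dilated ball. *)
Lemma oscillation_bound (z : X) (r : R) : 0 < r ->
  exists M : R, 0 <= M /\ forall del, 0 < del -> del <= 1 ->
  (\int[mu]_(x in ball z r) `|g x - mean mu (ball z r) g|%:E <=
    (M * del `^ p^-1)%:E)%E.
Proof.
move=> r0; have [lam [cP [lam1 cP0 poiP]]] := poi.
have lr0 : 0 < lam * r by rewrite mulr_gt0// (lt_le_trans _ lam1).
have p0 : 0 < p by rewrite (lt_le_trans _ p1).
set M1 := 12 * c ^+ 2 * (1 + 2 * m z r).
set M2 := m z r * (cP * r) * ((m z (lam * r))^-1 *
      ((1 + 2 * c ^+ 3) * (6 * c ^+ 2)) `^ p *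
      (1 + m z (lam * r))) `^ p^-1.
have M10 : 0 <= M1.
  apply: mulr_ge0; first by rewrite mulr_ge0 ?sqr_ge0.
  by rewrite addr_ge0// mulr_ge0 ?fine_ge0.
have M20 : 0 <= M2.
  by rewrite /M2 !mulr_ge0 ?powR_ge0 ?fine_ge0// ltW.
exists (2 * (M1 + M2)); split; first by rewrite mulr_ge0// addr_ge0.
move=> del d0 d1.
have /fine_cvgP[Efin /cvgr_lt] := integral_energy_cvg0 mub p1 mg z lr0 loc.
move=> /(_ del d0) Elt.
have tn : \forall n \near \oo, n.+1%:R^-1 < del by exact: near_infty_natSinv_lt (PosNum d0).
have [n [[Ef /= El] td]] := @filter_ex _ _ _ _ (filterI (filterI Efin Elt) tn).
set t := n.+1%:R^-1 in Ef El td; have t0 : 0 < t by rewrite invr_gt0.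
have Ed : (\int[mu]_(x in ball z (lam * r)) energy mu p t g x <= del%:E)%E.
  by rewrite -(fineK Ef) lee_fin ltW.
have mB := measurable_ball z r.
have Ed' : (\int[mu]_(x in ball z r) energy mu p t g x <= del%:E)%E.
  apply: le_trans Ed; apply: ge0_subset_integral => //.
  - exact: measurable_ball.
  - exact: measurable_funTS (measurable_energy mub p1 mg t).
  - by move=> x _; exact: energy_ge0.
  - by apply: le_ball; rewrite ler_peMl// ltW.
set u := averaged mu t g; set a := mean mu (ball z r) u.
have mu_ : measurable_fun setT u.
  exact: measurable_lipschitz (lipschitz_averaged mub doub t0 mg g1).
rewrite (le_trans (integral_sub_mean_le a mB (mub z r0) mg g1))//.
rewrite -mulrA EFinM lee_wpmul2l ?lee_fin//.
have near_u := integral_averaged_near r0 t0 (ltW td) d1 Ed'.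
have mean_u := integral_averaged_sub_mean r0 lam1 cP0 t0 (ltW td) d1
  (poiP z r u r0 (lipschitz_averaged mub doub t0 mg g1)) Ed.
rewrite (@le_trans _ _ (\int[mu]_(x in ball z r)
    (`|u x - g x|%:E + `|u x - a|%:E)))%E//.
  apply: le_integral_ge0 => // x _.
  by rewrite -EFinD lee_fin (distrC (u x) (g x)) ler_distD.
have mabs (h : X -> R) : measurable_fun setT h ->
    measurable_fun (ball z r) (fun x => `|h x|%:E).
  move=> mh; apply/measurable_EFinP/measurable_funTS.
  exact: (measurableT_comp (@normr_measurable R setT) mh).
rewrite ge0_integralD//; last 2 first.
- by apply: mabs; exact: measurable_funB.
- by apply: mabs; exact: measurable_funB.
rewrite mulrDl EFinD; apply: leeD; last exact: mean_u.
rewrite (le_trans near_u)// lee_fin ler_wpM2l//.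
by apply: ger1_powR; rewrite ?d0// invf_le1.
Qed.

Lemma oscillation_eq0 (z : X) (r : R) : 0 < r ->
  (\int[mu]_(x in ball z r) `|g x - mean mu (ball z r) g|%:E = 0)%E.
Proof.
move=> r0; have p0 : 0 < p by rewrite (lt_le_trans _ p1).
have [M [M0 MP]] := oscillation_bound z r0.
apply/eqP; rewrite eq_le integral_ge0 ?andbT//.
apply/lee_addgt0Pr => e e0; rewrite add0e.
(* [M] may be 0, hence the division by [M + 1]. *)
have q0 : 0 < e / (M + 1) by rewrite divr_gt0// ltr_wpDl.
pose del := Num.min 1 ((e / (M + 1)) `^ p).
have d0 : 0 < del by rewrite /del lt_min ltr01 powR_gt0.
have d1 : del <= 1 by rewrite /del ge_min lexx.
rewrite (le_trans (MP del d0 d1))// lee_fin.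
have : del `^ p^-1 <= e / (M + 1).
  have -> : e / (M + 1) = ((e / (M + 1)) `^ p) `^ p^-1.
    by rewrite -powRrM mulfV ?gt_eqF// powRr1// ltW.
  apply: ge0_ler_powR; rewrite ?nnegrE ?powR_ge0 ?invr_ge0 ?(ltW p0) ?(ltW d0)//.
  by rewrite /del ge_min lexx orbT.
move=> /(ler_wpM2l M0) /le_trans; apply.
by rewrite mulrCA ler_piMr ?(ltW e0)// ler_pdivrMr ?ltr_wpDl// mul1r lerDl.
Qed.

End vanishing_oscillation.

(** * Reduction to bounded functions *)

(* Bounded, 1-Lipschitz and injective, hence a substitute for truncation. *)
Definition squash (R : realType) (u : R) : R := u / (1 + `|u|).

Section squash.
Context (R : realType).
Implicit Types u v : R.

Let den_gt0 u : 0 < 1 + `|u|. Proof. by rewrite ltr_pwDl. Qed.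

Lemma squash_le1 u : `|squash u| <= 1.
Proof.
rewrite /squash normrM normfV (ger0_norm (ltW (den_gt0 u))).
by rewrite ler_pdivrMr// mul1r lerDr.
Qed.

Lemma squashB u v : squash u - squash v =
  (u - v + (u * `|v| - v * `|u|)) / ((1 + `|u|) * (1 + `|v|)).
Proof.
by rewrite /squash; field; rewrite !gt_eqF.
Qed.

(** For equal signs the term [u * |v| - v * |u|] of [squashB] vanishes. For opposite signs the
    numerator has absolute value [|u| + |v| + 2 * |u| * |v|], at most
    [(|u| + |v|) * (1 + |u| + |v|)]. *)
Lemma squash_lip u v : `|squash u - squash v| <= `|u - v|.
Proof.
rewrite squashB normrM normfV (ger0_norm (ltW (mulr_gt0 (den_gt0 u) (den_gt0 v)))).
rewrite ler_pdivrMr ?mulr_gt0//.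
have [u0|/ltW u0] := leP 0 u; have [v0|/ltW v0] := leP 0 v.
- rewrite (ger0_norm u0) (ger0_norm v0) (mulrC v u) subrr addr0 ler_peMr//.
  by have := mulr_ge0 u0 v0; nra.
- have : 0 <= - v by rewrite oppr_ge0.
  move: (- v) (opprK v) => w <- w0; rewrite (ger0_norm u0) normrN (ger0_norm w0).
  have uw := mulr_ge0 u0 w0.
  by rewrite !ger0_norm; nra.
- have : 0 <= - u by rewrite oppr_ge0.
  move: (- u) (opprK u) => w <- w0; rewrite (ger0_norm v0) normrN (ger0_norm w0).
  have vw := mulr_ge0 v0 w0.
  rewrite (_ : - w - v + _ = - (w + v + 2 * (v * w))); last by ring.
  rewrite -opprD !normrN !ger0_norm; nra.
- rewrite (ler0_norm u0) (ler0_norm v0).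
  rewrite (_ : u * - v - v * - u = 0); last by ring.
  rewrite addr0 ler_peMr//.
  by have := mulr_le0 u0 v0; nra.
Qed.

(** [squash] preserves signs, and for equal signs the products cancel in
    [u * (1 + |v|) = v * (1 + |u|)]. *)
Lemma squash_inj : injective (@squash R).
Proof.
move=> u v; rewrite /squash => /eqP.
rewrite eqr_div ?(gt_eqF (den_gt0 _))// => /eqP uv.
have sgn : (0 <= u) = (0 <= v).
  rewrite -(pmulr_lge0 u (den_gt0 v)) -(pmulr_lge0 v (den_gt0 u)).
  by rewrite mulrC -uv mulrC.
move: uv sgn; have [u0|u0] := leP 0 u; have [v0|v0] := leP 0 v => // uv _.
  by move: uv; rewrite (ger0_norm u0) (ger0_norm v0) !mulrDr !mulr1 (mulrC v u)
    => /addIr.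
move: uv; rewrite (ltr0_norm u0) (ltr0_norm v0) !mulrDr !mulr1 !mulrN (mulrC v u).
by move=> /addIr.
Qed.

Lemma measurable_squash : measurable_fun setT (@squash R).
Proof.
apply: (eq_measurable_fun (fun u : R => u * (1 + `|u|) `^ (-1))).
  by move=> u _; rewrite powR_inv1// ltW.
apply: measurable_funM => //.
apply: (measurableT_comp (@measurable_powR R _)).
by apply: measurable_funD => //; exact: normr_measurable.
Qed.

End squash.

(** * Almost everywhere constancy and the Besov space *)

Section conclusion.
Context d (R : realType) (X : borelMetricType d R).
Variable mu : {sigma_finite_measure set X -> \bar R}.
Variable p : R.
Hypotheses (p1 : 1 <= p) (dbl : doubling mu).

Let mub : forall (x : X) (r : R), 0 < r -> (0 < mu (ball x r) < +oo)%E.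
Proof. by case: dbl. Qed.

(** Provides a point outside an exceptional set, at which the value of the constant is read off.
    Radius 1 puts it in every ball [ball x0 n.+1%:R], so the constants found on these balls
    agree. *)
Lemma ex_notin_null (N : set X) (x0 : X) : measurable N -> mu N = 0%E ->
  exists x, ball x0 1 x /\ ~ N x.
Proof.
move=> mN N0; apply: contrapT => noN; have /andP[+ _] := mub x0 ltr01.
apply/negP; rewrite -leNgt -N0; apply: le_measure; rewrite ?inE//.
  exact: measurable_ball.
by move=> x xB; apply: contrapT => xN; apply: noN; exists x.
Qed.

Lemma ae_constant_bounded (g : X -> R) : measurable_fun setT g ->
  (forall x, `|g x| <= 1) -> poincare mu p ->
  L1loc_prod mu (besov_integrand mu p g) -> ae_constant mu g.
Proof.
move=> mg g1 poi loc; have [_ [c doub]] := dbl.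
have [[x0 _]|X0] := pselect (exists x : X, True); last first.
  by exists 0; apply/nearW => x; case: X0; exists x.
pose w n := mean mu (ball x0 n.+1%:R) g.
have aen n : {ae mu, forall x, ball x0 n.+1%:R x -> g x = w n}.
  have mB := measurable_ball x0 (n.+1%:R : R).
  have mf : measurable_fun (ball x0 n.+1%:R) (fun x => (g x - w n)%:E).
    by apply/measurable_EFinP/measurable_funTS; exact: measurable_funB.
  have [+ _] := ae_eq_integral_abs mu mB mf.
  move=> /(_ (oscillation_eq0 mub doub p1 mg g1 poi loc x0 (ltr0Sn R n))).
  apply: filterS => x + xB => /(_ xB) [] /eqP; rewrite subr_eq0.
  by move/eqP.
have := ae_foralln aen; move=> [N [mN N0 NP]].
have [x1 [x1B x1N]] := ex_notin_null x0 mN N0.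
have good x : ~ N x -> forall n, ball x0 n.+1%:R x -> g x = w n.
  by move=> xN; apply: contrapT => xP; apply/xN/NP.
exists (g x1); exists N; split => // x /= xg.
apply: contrapT => xN; apply: xg.
pose n := Num.bound (mdist x0 x).
rewrite (good x xN n) 1?(good x1 x1N n)//.
  by apply: (le_ball _ x1B); rewrite ler1n.
rewrite ballEmdist /= (lt_le_trans (archi_boundP (mdist_ge0 _ _)))//.
by rewrite ler_nat.
Qed.

Lemma ae_constant_besov (f : X -> R) : poincare mu p -> measurable_fun setT f ->
  L1loc_prod mu (besov_integrand mu p f) -> ae_constant mu f.
Proof.
move=> poi mf loc; pose g := @squash R \o f.
have mg : measurable_fun setT g := measurableT_comp (@measurable_squash R) mf.
have [||||a ga] := @ae_constant_bounded g => //.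
- by move=> x; exact: squash_le1.
- move=> z r r0; have mB := measurable_ball z r.
  (* [squash] is 1-Lipschitz, so the integrand of [g] is dominated by that of [f]. *)
  apply: le_integrable (loc z r r0).
  + exact: measurableX.
  + apply: measurable_funTS.
    exact: (measurable_besov_integrand mub (p_neq0 p1) mg).
  + move=> xy _; rewrite !gee0_abs ?besov_integrand_ge0//.
    rewrite !besov_integrandE ?p_neq0// lee_fin.
    rewrite ler_wpM2r ?invr_ge0 ?fine_ge0//.
    apply: ge0_ler_powR; rewrite ?nnegrE ?divr_ge0 ?mdist_ge0//.
      by rewrite (le_trans _ p1).
    by rewrite ler_wpM2r ?invr_ge0 ?mdist_ge0// squash_lip.
have [[x0 _]|X0] := pselect (exists x : X, True); last first.
  by exists 0; apply/nearW => x; case: X0; exists x.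
have [N [mN N0 NP]] := ga.
have [x1 [_ x1N]] := ex_notin_null x0 mN N0.
have good x : ~ N x -> g x = a.
  by move=> xN; apply: contrapT => xP; apply/xN/NP.
exists (f x1); exists N; split => // x /= xg.
apply: contrapT => xN; apply: xg; apply: (@squash_inj R).
by rewrite -[LHS]/(g x) -[RHS]/(g x1) !good.
Qed.

Lemma constant_Lloc (f : X -> R) : measurable_fun setT f -> ae_constant mu f ->
  Lloc mu p f.
Proof.
move=> mf [a fa]; split => // x r r0; have mB := measurable_ball x r.
have mfB : measurable_fun setT (f \_ (ball x r)).
  by apply: (measurable_restrictT _ mB).1; exact: measurable_funTS.
apply/andP; split; rewrite inE//=; rewrite /finite_norm unlock.
apply: poweR_lty.
rewrite (@ge0_ae_eq_integral _ _ _ mu setT _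
  (fun y => (`|a| `^ p * \1_(ball x r) y)%:E))//.
- under eq_integral do rewrite EFinM.
  rewrite ge0_integralZl//; last by apply/measurable_EFinP; exact: measurable_indic.
  rewrite integral_indic ?setIT//.
  have /andP[_ moo] := mub x r0.
  by rewrite lte_mul_pinfty ?lee_fin ?powR_ge0.
- apply/measurable_EFinP; apply: (measurableT_comp (@measurable_powR R p)).
  exact: (measurableT_comp (@normr_measurable R setT) mfB).
- by apply/measurable_EFinP; apply: measurable_funM.
- by move=> y _; exact: poweR_ge0.
- apply: filterS fa => y fy _ /=; congr (_%:E).
  rewrite patchE indicE; case: ifPn => _; rewrite ?mulr1 ?fy//.
  by rewrite normr0 mulr0 powR0// p_neq0.
Qed.

(** If [f = a] outside a null set [N], the integrand vanishes outside the product-null set of pairs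
    with a coordinate in [N]. *)
Lemma constant_besov0 (f : X -> R) : measurable_fun setT f -> ae_constant mu f ->
  (\int[mu \x mu]_xy besov_integrand mu p f xy = 0)%E.
Proof.
move=> mf [a [N [mN N0 NP]]].
rewrite (@ge0_ae_eq_integral _ _ _ (mu \x mu)%E setT _ (cst 0%E))//.
- by rewrite integral0.
- exact: (measurable_besov_integrand mub (p_neq0 p1) mf).
- by move=> xy _; exact: besov_integrand_ge0.
have good x : ~ N x -> f x = a.
  by move=> xN; apply: contrapT => xP; apply/xN/NP.
have n1 : (mu \x mu)%E.-negligible (N `*` setT).
  exists (N `*` setT); split => //; first exact: measurableX.
  by rewrite product_measure1E// N0 mul0e.
have n2 : (mu \x mu)%E.-negligible (setT `*` N).
  exists (setT `*` N); split => //; first exact: measurableX.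
  by rewrite product_measure1E// N0 mule0.
apply: negligibleS (negligibleU n1 n2) => -[x y] /= xy.
apply: contrapT => /not_orP[xN yN]; apply: xy => _.
rewrite besov_integrandE ?p_neq0//= !good ?subrr ?normr0 ?mul0r ?powR0 ?p_neq0//.
- by rewrite mul0r.
- by move=> ?; apply: yN.
- by move=> ?; apply: xN.
Qed.

End conclusion.
Unset Implicit Arguments.

Theorem proposition4p1 (d : measure_display) (R : realType)
    (X : borelMetricType d R) (mu : {measure set X -> \bar R}) (p : R) :
  1 <= p -> doubling mu -> poincare mu p ->
  (forall f : X -> R,
      Lloc mu 1 f -> L1loc_prod mu (besov_integrand mu p f) ->
      ae_constant mu f) /\
  besov1 mu p = constants mu.
Proof.
move=> p1 dbl poi.
have [nu nuE] := sigma_finite_measure_pack (sigma_finite_balls dbl.1).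
move: dbl poi; rewrite nuE => dbl poi; have mub := dbl.1; split.
  by move=> f [mf _] loc; exact: (ae_constant_besov p1 dbl poi mf).
apply/seteqP; split => f /= [].
  move=> [mf _] foo; split => //; apply: (ae_constant_besov p1 dbl poi mf).
  move=> z r r0; have mB := measurable_ball z r.
  have mb := measurable_besov_integrand mub (p_neq0 p1) mf.
  apply: (integrableS measurableT) => //; first exact: measurableX.
  apply/integrableP; split => //.
  by under eq_integral do rewrite gee0_abs ?besov_integrand_ge0//.
move=> mf fa; split; first exact: constant_Lloc.
by rewrite constant_besov0.
Qed.
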